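(* Let $(Q,P)$ be a weakly quasi-lattice ordered group, and let $\Lambda$ be a finitely aligned $P$-graph. Let $G_{\Lambda,\mathrm m}$ and $G_{\Lambda,\mathrm f}$ be the path groupoids of graph morphisms and of filters of $\Lambda$. The map $$\psi_h\colon G_{\Lambda,\mathrm m}\to G_{\Lambda,\mathrm f},\qquad (x,q,y)\mapsto (x(e\,\mathrm{dom}(x)),\,q,\,y(e\,\mathrm{dom}(y))),$$ is an isomorphism of topological groupoids. The set $\partial\Lambda_{\mathrm m}$ is a closed and invariant subset of $X_{\Lambda,\mathrm m}$, and $\psi_h$ restricts to an isomorphism of topological groupoids from $\partial G_{\Lambda,\mathrm m}=G_{\Lambda,\mathrm m}|_{\partial\Lambda_{\mathrm m}}$ to $\partial G_{\Lambda,\mathrm f}=G_{\Lambda,\mathrm f}|_{\partial\Lambda_{\mathrm f}}$.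
   Context: Weakly quasi-lattice ordered groups. Let $Q$ be a discrete group and $P\subseteq Q$ a submonoid with $P\cap P^{-1}=\{e\}$. For $p,r\in P$ write $p\le r$ if $pq=r$ for some $q\in P$; this is a left-invariant partial order. $(Q,P)$ is weakly quasi-lattice ordered if any two elements of $P$ with a common upper bound have a least common upper bound. $P$-graphs. A $P$-graph is a countable small category $\Lambda$ (identified with its set of morphisms; composable pairs $\Lambda^{(2)}$, units $\Lambda^{(0)}$, range $\mathbf r$, source $\mathbf s$, $\lambda\mu$ defined iff $\mathbf s(\lambda)=\mathbf r(\mu)$) with a functor $\mathbf d\colon\Lambda\to P$ satisfying unique factorisation: if $\mathbf d(\lambda)=pq$ with $p,q\in P$, there are unique $\mu,\nu\in\Lambda$ with $\lambda=\mu\nu$, $\mathbf d(\mu)=p$, $\mathbf d(\nu)=q$. Write $\Lambda^p=\mathbf d^{-1}(p)$ and $\mu\Lambda=\{\mu\nu : \mathbf s(\mu)=\mathbf r(\nu)\}$. $\Lambda$ is finitely aligned if for all $\mu,\nu\in\Lambda$ there is a finite $J\subseteq\Lambda$ with $\mu\Lambda\cap\nu\Lambda=\bigcup_{\lambda\in J}\lambda\Lambda$. Write $\mu\preceq\lambda$ if $\lambda\in\mu\Lambda$ (a partial order). A graph morphism is a degree-preserving functor. A set $E\subseteq\Lambda$ is exhaustive if for all $\lambda\in\Lambda$ with $\mathbf r(\lambda)\in\mathbf r(E)$ there is $\mu\in E$ with $\lambda\Lambda\cap\mu\Lambda\neq\emptyset$. Path prototypes. For $m\in P$, $\Omega_{P,m}=\{(p,q)\in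 P\times P : p\le q\le m\}$, where $(p,q),(q',r)$ are composable iff $q=q'$, $(p,q)(q,r)=(p,r)$, and $\mathbf d(p,q)=p^{-1}q$. A sequence $(m_n)\subseteq P$ is $\le$-increasing if $m_j\le m_k$ whenever $j<k$; then $\Omega_{P,(m_n)}=\bigcup_n\Omega_{P,m_n}$ with the evident category structure and degree functor. Graph morphism path space. $X_{\Lambda,\mathrm m}$ is the set of graph morphisms $x\colon\Omega_{P,(m_n)}\to\Lambda$ with $(m_n)\subseteq P$ $\le$-increasing; $\mathrm{dom}(x)$ denotes the domain of $x$ and $e\,\mathrm{dom}(x)=\{(p,q)\in\mathrm{dom}(x) : p=e\}$. Its topology has as basis the sets $\{x : K_1\subseteq x(e\,\mathrm{dom}(x))\subseteq\Lambda\setminus K_2\}$ with $K_1,K_2\subseteq\Lambda$ finite (possibly empty). The partial action of $P$: $X_{\Lambda,\mathrm m}*P=\{(x,m) : (e,m)\in\mathrm{dom}(x)\}$, and $x\cdot m$ is the graph morphism with $(p,q)\in\mathrm{dom}(x\cdot m)\iff(mp,mq)\in\mathrm{dom}(x)$ and $(x\cdot m)(p,q)=x(mp,mq)$. The boundary-path space $\partial\Lambda_{\mathrm m}$ is the set of $x\in X_{\Lambda,\mathrm m}$ such that, if $(e,m)\in\mathrm{dom}(x)$ and $E\subseteq\Lambda$ is finite, exhaustive and $\mathbf s(x(e,m))\in\mathbf r(E)$, then there is $\nu\in E$ with $x(m,m\mathbf d(\nu))=\nu$ (in particular $(m,m\mathbf d(\nu))\in\mathrm{dom}(x)$). Filter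 path space. A filter of $\Lambda$ is a nonempty $x\subseteq\Lambda$ that is hereditary ($\lambda\preceq\mu\in x$ implies $\lambda\in x$) and directed ($\mu,\nu\in x$ implies there is $\lambda\in x$ with $\mu,\nu\preceq\lambda$). $X_{\Lambda,\mathrm f}$ is the set of filters, with topology having as basis the sets $\{x : K_1\subseteq x\subseteq\Lambda\setminus K_2\}$ with $K_1,K_2\subseteq\Lambda$ finite (possibly empty). For each filter $x$, $\mathbf d|_x$ is injective. The partial action of $P$: $X_{\Lambda,\mathrm f}*P=\{(x,m) : x\cap\Lambda^m\ne\emptyset\}$ and $x\cdot m=\{\nu\in\Lambda : \mu\nu\in x\}$, where $\mu$ is the unique element of $x\cap\Lambda^m$. An ultrafilter is a filter $x$ such that $x\subseteq y\in X_{\Lambda,\mathrm f}$ implies $x=y$. The boundary-path space $\partial\Lambda_{\mathrm f}$ is the closure in $X_{\Lambda,\mathrm f}$ of the set of ultrafilters (it is a closed invariant subset). Groupoids. Let $X$ be $X_{\Lambda,\mathrm m}$ or $X_{\Lambda,\mathrm f}$ (both actions are locally compact and directed, so the following is defined). The semidirect product groupoid $G_X$ is the set of $(x,q,y)\in X\times Q\times X$ for which there are $m,n\in P$ with $q=mn^{-1}$, $(x,m),(y,n)\in X*P$ and $x\cdot m=y\cdot n$; $(x,q,y),(w,r,z)$ are composable iff $y=w$, $(x,q,y)(y,r,z)=(x,qr,z)$, and $(x,q,y)^{-1}=(y,q^{-1},x)$. Its topology has as basis the sets $\{(x,mn^{-1},y)\in G_X : x\in U,\ y\in V,\ x\cdot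 m=y\cdot n\}$ for $m,n\in P$ and $U,V\subseteq X$ open. $G_{\Lambda,\mathrm m}$ and $G_{\Lambda,\mathrm f}$ are the groupoids $G_X$ for $X=X_{\Lambda,\mathrm m}$ and $X=X_{\Lambda,\mathrm f}$, respectively. A subset $U\subseteq X$ is invariant if for all $x\in X$, $y\in U$, $m,n\in P$, $x\cdot m=y\cdot n$ (both defined) implies $x\in U$. The reduction is $G_X|_U=\{(x,q,y)\in G_X : x,y\in U\}$ with the subspace topology. An isomorphism of topological groupoids is a homeomorphism that preserves and reflects composability and preserves composition and inversion. *)

(* Defs.v *)
From HB Require Import structures.
From mathcomp Require Import all_boot all_classical topology.

Set Implicit Arguments.
Unset Strict Implicit.
Unset Printing Implicit Defensive.

Local Open Scope classical_set_scope.
Local Open Scope group_scope.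

Definition ple (Q : groupType) (P : set Q) (p r : Q) : Prop :=
  exists2 q, P q & p * q = r.

Record wqlo_group := WqloGroup {
  wqlo_carrier :> groupType;
  pos : set wqlo_carrier;
  pos1 : pos 1;
  posM : forall p q, pos p -> pos q -> pos (p * q);
  pos_anti : forall p, pos p -> pos p^-1 -> p = 1;
  pos_lub : forall p q, pos p -> pos q ->
    (exists u, [/\ pos u, ple pos p u & ple pos q u]) ->
    exists l, [/\ pos l, ple pos p l, ple pos q l &
      forall u, pos u -> ple pos p u -> ple pos q u -> ple pos l u] }.

Arguments pos {w}.
Notation "p <=p r" := (ple pos p r) (at level 70, no associativity).

(* A category is identified with its set of morphisms; the units are the
   morphisms [rng l] and [src l].  The value [l ** m] is
   meaningful only if [src l = rng m]; it is never used otherwise. *)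
Record small_category := SmallCategory {
  mor :> Type;
  rng : mor -> mor;
  src : mor -> mor;
  cat_comp : mor -> mor -> mor;
  src_rng : forall l, src (rng l) = rng l;
  rng_src : forall l, rng (src l) = src l;
  rng_comp : forall l m, src l = rng m -> rng (cat_comp l m) = rng l;
  src_comp : forall l m, src l = rng m -> src (cat_comp l m) = src m;
  comp1l : forall l, cat_comp (rng l) l = l;
  comp1r : forall l, cat_comp l (src l) = l;
  compA : forall l m n, src l = rng m -> src m = rng n ->
    cat_comp (cat_comp l m) n = cat_comp l (cat_comp m n) }.

Notation "l ** m" := (cat_comp l m) (at level 40, left associativity).

Section Category.
Variable L : small_category.
Implicit Types (l m n : L) (E x : set L).

Definition ideal m : set L := [set l | exists2 n, src m = rng n & m ** n = l].

Definition finitely_aligned : Prop := forall m n,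
  exists2 J : set L, finite_set J & ideal m `&` ideal n = \bigcup_(l in J) ideal l.

Definition exhaustive E : Prop := forall l, (@rng L @` E) (rng l) ->
  exists2 m, E m & ideal l `&` ideal m !=set0.

Definition mle m l : Prop := ideal m l.

Definition is_path_filter x : Prop :=
  [/\ x !=set0,
      forall l m, mle l m -> x m -> x l
    & forall m n, x m -> x n -> exists l, [/\ x l, mle m l & mle n l]].

Record path_filter := PathFilter {
  filter_set :> set L;
  path_filterP : is_path_filter filter_set }.

Definition ultrafilter (x : path_filter) : Prop :=
  forall y : path_filter, x `<=` y -> x = y.

Lemma path_filter_inj (x y : path_filter) : x = y :> set L -> x = y.
Proof.
case: x y => [x xP] [y yP] /= xy; move: xy yP => <- yP.
by congr PathFilter; exact: Prop_irrelevance.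
Qed.

End Category.

Record pgraph (Q : wqlo_group) := PGraph {
  pcat :> small_category;
  deg : pcat -> Q;
  pgraph_countable : countable [set: pcat];
  deg_pos : forall l, pos (deg l);
  deg_unit : forall l, deg (rng l) = 1;
  deg_comp : forall l m, src l = rng m -> deg (l ** m) = deg l * deg m;
  unique_factorisation : forall l p q, pos p -> pos q -> deg l = p * q ->
    exists! mn : pcat * pcat, [/\ src mn.1 = rng mn.2, mn.1 ** mn.2 = l,
                                  deg mn.1 = p & deg mn.2 = q] }.

Section PGraphTheory.
Variables (Q : wqlo_group) (L : pgraph Q).
Implicit Types (l m n : L).

Lemma factor_inj m n m' n' : src m = rng n -> src m' = rng n' ->
  m ** n = m' ** n' -> deg m = deg m' -> m = m' /\ n = n'.
Proof.
move=> mn mn' e dm.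
have dn : deg n = deg n'.
  by apply: (@mulgI _ (deg m)); rewrite -deg_comp // e deg_comp // dm.
have [] := @unique_factorisation _ L (m ** n) (deg m) (deg n).
- exact: deg_pos.
- exact: deg_pos.
- exact: deg_comp.
move=> z [_ zu].
have := zu (m, n) (And4 mn erefl erefl erefl) => /=.
by rewrite (zu (m', n') (And4 mn' (esym e) (esym dm) (esym dn))) => -[-> ->].
Qed.

Lemma ple_trans (p q r : Q) : p <=p q -> q <=p r -> p <=p r.
Proof.
move=> [a Pa <-] [b Pb <-]; exists (a * b); last by rewrite mulgA.
exact: posM.
Qed.

Lemma ple_mul2l (m p q : Q) : m * p <=p m * q <-> p <=p q.
Proof.
split=> -[a Pa e]; exists a => //; last by rewrite -mulgA e.
by apply: (@mulgI _ m); rewrite mulgA.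
Qed.

Lemma mle_deg m l : mle m l -> deg m <=p deg l.
Proof.
by move=> [n mn <-]; exists (deg n); [exact: deg_pos|rewrite deg_comp].
Qed.

End PGraphTheory.

Section PathTopology.
Variables (X L : Type) (h : X -> set L).

Definition cylinder (K1 K2 : set L) : set X :=
  [set x | K1 `<=` h x /\ h x `<=` ~` K2].

Definition cylinders : set (set X) :=
  [set B | exists K1 K2, [/\ finite_set K1, finite_set K2 & B = cylinder K1 K2]].

Lemma cylinders_cover : \bigcup_(B in cylinders) B = [set: X].
Proof.
apply/seteqP; split=> // x _; exists (cylinder set0 set0); last first.
  by split=> [l []|l _ []].
by exists set0, set0; split=> //; exact: finite_set0.
Qed.

Lemma cylinders_join A B x : cylinders A -> cylinders B -> A x -> B x ->
  exists C, [/\ cylinders C, C x & C `<=` A `&` B].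
Proof.
move=> [K1 [K2 [fK1 fK2 ->]]] [J1 [J2 [fJ1 fJ2 ->]]] [xK1 xK2] [xJ1 xJ2].
exists (cylinder (K1 `|` J1) (K2 `|` J2)); split.
- by exists (K1 `|` J1), (K2 `|` J2); rewrite !finite_setU.
- by split=> l; [move=> [/xK1|/xJ1]|move=> xl [/(xK2 _ xl)|/(xJ2 _ xl)]].
- move=> y [y1 y2]; split; split=> l.
  + by move=> ?; apply: y1; left.
  + by move=> /y2 yl ?; apply: yl; left.
  + by move=> ?; apply: y1; right.
  + by move=> /y2 yl ?; apply: yl; right.
Qed.

End PathTopology.

HB.instance Definition _ (L : small_category) := gen_eqMixin (path_filter L).
HB.instance Definition _ (L : small_category) := gen_choiceMixin (path_filter L).
HB.instance Definition _ (L : small_category) :=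
  isBaseTopological.Build (path_filter L)
    (cylinders_cover (@filter_set L)) (@cylinders_join _ _ (@filter_set L)).

Section GraphMorphisms.
Variables (Q : wqlo_group) (L : pgraph Q).

Definition Omega (m : Q) : set (Q * Q) :=
  [set pq | [/\ pos pq.1, pos pq.2, pq.1 <=p pq.2 & pq.2 <=p m]].

Definition increasing_seq (m_ : nat -> Q) : Prop :=
  (forall n, pos (m_ n)) /\ (forall j k : nat, (j < k)%N -> m_ j <=p m_ k).

Definition Omega_seq (m_ : nat -> Q) : set (Q * Q) := \bigcup_n Omega (m_ n).

(* A graph morphism defined on some [Omega_seq m_] is encoded as a partial
   function on [Q * Q], so that two of them are equal iff they have the same
   domain and the same values.  In the category [Omega_seq m_], the pair [(p, q)]
   has range [(p, p)] and source [(q, q)]. *)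
Definition pdom (x : Q * Q -> option L) : set (Q * Q) := [set pq | x pq <> None].

Definition is_graph_morphism (x : Q * Q -> option L) : Prop :=
  [/\ exists2 m_, increasing_seq m_ & pdom x = Omega_seq m_,
      forall p q l, x (p, q) = Some l ->
        x (p, p) = Some (rng l) /\ x (q, q) = Some (src l),
      forall p q r l m, x (p, q) = Some l -> x (q, r) = Some m ->
        x (p, r) = Some (l ** m)
    & forall p q l, x (p, q) = Some l -> deg l = p^-1 * q].

Record graph_morphism := GraphMorphism {
  gmap :> Q * Q -> option L;
  gmapP : is_graph_morphism gmap }.

Lemma graph_morphism_inj (x y : graph_morphism) : x =1 y -> x = y.
Proof.
case: x y => [x xP] [y yP] /= /funext xy; move: xy yP => <- yP.
by congr GraphMorphism; exact: Prop_irrelevance.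
Qed.

Definition edom (x : graph_morphism) : set (Q * Q) :=
  [set pq | pdom x pq /\ pq.1 = 1].

(* the set [x(e dom(x))] *)
Definition hull (x : graph_morphism) : set L :=
  [set l | exists2 pq, edom x pq & x pq = Some l].

HB.instance Definition _ := gen_eqMixin graph_morphism.
HB.instance Definition _ := gen_choiceMixin graph_morphism.
HB.instance Definition _ := isBaseTopological.Build graph_morphism
  (cylinders_cover hull) (@cylinders_join _ _ hull).

End GraphMorphisms.

(* Only the algebraic part of the definition is recorded: openness and continuity
   are not needed to define the semidirect product.  Directedness is stated
   pointwise, which is what closure under composition uses.
   [act_dom x m] means that [x . m] is defined; it is then [act h] for any proof
   [h : act_dom x m]. *)
Record directed_action (Q : wqlo_group) := DirectedAction {
  act_space :> topologicalType;
  act_dom : act_space -> Q -> Prop;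
  act : forall x m, act_dom x m -> act_space;
  act_pos : forall x m, act_dom x m -> pos m;
  act_dom1 : forall x, act_dom x 1;
  act1 : forall x (h : act_dom x 1), act h = x;
  act_domM : forall x m n, pos m -> pos n ->
    act_dom x (m * n) <-> exists h : act_dom x m, act_dom (act h) n;
  actM : forall x m n (h : act_dom x m) (hn : act_dom (act h) n)
    (hmn : act_dom x (m * n)), act hmn = act hn;
  act_directed : forall x m n, act_dom x m -> act_dom x n ->
    exists l, [/\ act_dom x l, m <=p l & n <=p l] }.

Section SemidirectProduct.
Variables (Q : wqlo_group) (X : directed_action Q).
Implicit Types (x y z : X) (m n : Q).

(* [x . m = y . n], both sides being defined *)
Definition act_eq x m y n : Prop :=
  exists (h : act_dom x m) (k : act_dom y n), act h = act k.

Definition act_invariant (U : set X) : Prop :=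
  forall x y m n, U y -> act_eq x m y n -> U x.

Definition in_sdp x (q : Q) y : Prop :=
  exists m n, [/\ pos m, pos n, q = m * n^-1 & act_eq x m y n].

Record sdp := Sdp {
  sdp_rng : X;
  sdp_coc : Q;
  sdp_src : X;
  sdpP : in_sdp sdp_rng sdp_coc sdp_src }.

Lemma sdp_inj (g h : sdp) : sdp_rng g = sdp_rng h -> sdp_coc g = sdp_coc h ->
  sdp_src g = sdp_src h -> g = h.
Proof.
case: g h => [x q y gP] [x' q' y' hP] /= ex eq ey.
move: ex eq ey hP => <- <- <- hP; congr Sdp; exact: Prop_irrelevance.
Qed.

Lemma act_ext x y m n (h : act_dom x m) (k : act_dom y n) :
  x = y -> m = n -> act h = act k.
Proof.
by move=> xy mn; move: xy mn h k => <- <- h k; congr act; exact: Prop_irrelevance.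
Qed.

Lemma act_eqM x m y n a : act_eq x m y n -> pos a -> act_dom x (m * a) ->
  act_eq x (m * a) y (n * a).
Proof.
move=> [h [k hk]] Pa hma.
have Pm := act_pos h; have Pn := act_pos k.
have [h' ha] := (act_domM x Pm Pa).1 hma.
have ka : act_dom (act k) a.
  by rewrite -hk (_ : act h = act h') //; exact: act_ext.
have kna : act_dom y (n * a) by apply/(act_domM y Pn Pa); exists k.
exists hma, kna; rewrite (actM ha) (actM ka).
by apply: act_ext => //; rewrite -hk; exact: act_ext.
Qed.

Lemma act_eq_sym x m y n : act_eq x m y n -> act_eq y n x m.
Proof. by move=> [h [k hk]]; exists k, h. Qed.

Lemma act_eq_trans x m y n z l :
  act_eq x m y n -> act_eq y n z l -> act_eq x m z l.
Proof.
move=> [h [k hk]] [k' [j kj]]; exists h, j; rewrite hk -kj; exact: act_ext.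
Qed.

Lemma in_sdp_mul x q y r z : in_sdp x q y -> in_sdp y r z -> in_sdp x (q * r) z.
Proof.
move=> [m [n [Pm Pn -> xy]]] [k [l [Pk Pl -> yz]]].
have yn : act_dom y n by case: xy => h [].
have yk : act_dom y k by case: yz.
have [c [yna [a Pa ea] [b Pb eb]]] := act_directed yn yk.
rewrite -ea in yna.
have ykb : act_dom y (k * b) by rewrite eb -ea.
have {}xy : act_eq x (m * a) y (n * a).
  exact/act_eq_sym/(act_eqM (act_eq_sym xy) Pa).
have {}yz := act_eqM yz Pb ykb.
exists (m * a), (l * b); split; [exact: posM|exact: posM| |].
  have -> : m * n^-1 = m * a * (n * a)^-1 by rewrite invgM !mulgA mulgK.
  have -> : k * l^-1 = k * b * (l * b)^-1 by rewrite invgM !mulgA mulgK.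
  by rewrite ea eb mulgA mulgVK.
by apply: act_eq_trans xy _; rewrite ea -eb.
Qed.

Lemma in_sdp_inv x q y : in_sdp x q y -> in_sdp y q^-1 x.
Proof.
move=> [m [n [Pm Pn -> xy]]]; exists n, m; split=> //.
  by rewrite invgM invgK.
exact: act_eq_sym.
Qed.

Definition sdp_composable (g h : sdp) : Prop := sdp_src g = sdp_rng h.

Lemma sdp_mul_subproof g h : sdp_composable g h ->
  in_sdp (sdp_rng g) (sdp_coc g * sdp_coc h) (sdp_src h).
Proof.
move=> gh; apply: in_sdp_mul (sdpP h); rewrite -gh; exact: sdpP.
Qed.

Definition sdp_mul g h (gh : sdp_composable g h) : sdp :=
  Sdp (sdp_mul_subproof gh).

Definition sdp_inv (g : sdp) : sdp := Sdp (in_sdp_inv (sdpP g)).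

Definition sdp_basic m n (U V : set X) : set sdp :=
  [set g | [/\ U (sdp_rng g), V (sdp_src g), sdp_coc g = m * n^-1 &
               act_eq (sdp_rng g) m (sdp_src g) n]].

Definition sdp_basics : set (set sdp) :=
  [set B | exists m n U V, [/\ pos m, pos n, open U, open V &
                               B = sdp_basic m n U V]].

(* The topology generated by the sets [sdp_basic m n U V].  When the action is by
   local homeomorphisms, as for both path spaces, these sets form a basis. *)
HB.instance Definition _ := gen_eqMixin sdp.
HB.instance Definition _ := gen_choiceMixin sdp.
HB.instance Definition _ := isSubBaseTopological.Build sdp sdp_basics id.

End SemidirectProduct.

(* Continuity of the operations is not part of this structure, since it plays no
   role in the notion of isomorphism. *)
Record top_groupoid := TopGroupoid {
  gpd :> topologicalType;
  composable : gpd -> gpd -> Prop;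
  gmul : forall g h, composable g h -> gpd;
  ginv : gpd -> gpd;
  ginvK : forall g, ginv (ginv g) = g;
  gmulA : forall g h k (gh : composable g h) (hk : composable h k),
    exists (ghk : composable (gmul gh) k) (ghk' : composable g (gmul hk)),
      gmul ghk = gmul ghk';
  gcompV : forall g, composable (ginv g) g;
  gmulKl : forall g h (gh : composable g h),
    exists k : composable (ginv g) (gmul gh), gmul k = h;
  gmulKr : forall g h (gh : composable g h),
    exists k : composable (gmul gh) (ginv h), gmul k = g }.

Definition homeomorphism (S T : topologicalType) (f : S -> T) : Prop :=
  exists g : T -> S, [/\ cancel f g, cancel g f, continuous f & continuous g].

Definition groupoid_isomorphism (G H : top_groupoid) (f : G -> H) : Prop :=
  [/\ homeomorphism f,
      forall g h, composable g h <-> composable (f g) (f h),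
      forall g h (gh : composable g h) (fgh : composable (f g) (f h)),
        f (gmul gh) = gmul fgh
    & forall g, f (ginv g) = ginv (f g)].

Section SemidirectGroupoids.
Variables (Q : wqlo_group) (X : directed_action Q).

Definition sdp_groupoid : top_groupoid.
Proof.
refine (@TopGroupoid (sdp X) (@sdp_composable Q X) (@sdp_mul Q X)
  (@sdp_inv Q X) _ _ _ _ _).
- by move=> g; apply: sdp_inj => //=; rewrite invgK.
- by move=> g h k gh hk; exists hk, gh; apply: sdp_inj => //=; rewrite mulgA.
- by [].
- move=> g h gh; exists (erefl : sdp_composable (sdp_inv g) (sdp_mul gh)).
  by apply: sdp_inj => //=; rewrite mulKg.
- move=> g h gh; exists (erefl : sdp_composable (sdp_mul gh) (sdp_inv h)).
  by apply: sdp_inj => //=; rewrite mulgK.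
Defined.

(* As a [set_type], [reduction U] carries the subspace topology. *)
Definition reduction (U : set X) : set (sdp X) :=
  [set g | U (sdp_rng g) /\ U (sdp_src g)].

Section Reduction.
Variable U : set X.

Definition red_composable (g h : reduction U) : Prop :=
  sdp_composable (val g) (val h).

Lemma red_mul_subproof (g h : reduction U) (gh : red_composable g h) :
  sdp_mul gh \in reduction U.
Proof.
by apply/mem_set; split; [have /set_mem[] := valP g|have /set_mem[] := valP h].
Qed.

Definition red_mul (g h : reduction U) (gh : red_composable g h) : reduction U :=
  exist _ (sdp_mul gh) (red_mul_subproof gh).

Lemma red_inv_subproof (g : reduction U) : sdp_inv (val g) \in reduction U.
Proof. by apply/mem_set; have /set_mem[] := valP g. Qed.

Definition red_inv (g : reduction U) : reduction U :=
  exist _ (sdp_inv (val g)) (red_inv_subproof g).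

Definition reduction_groupoid : top_groupoid.
Proof.
refine (@TopGroupoid (reduction U) red_composable red_mul red_inv _ _ _ _ _).
- by move=> g; apply: val_inj; exact: (@ginvK sdp_groupoid).
- move=> g h k gh hk.
  have [ghk [ghk' e]] := @gmulA sdp_groupoid _ _ _ gh hk.
  by exists ghk, ghk'; apply: val_inj.
- by move=> g; exact: (@gcompV sdp_groupoid).
- move=> g h gh; have [k e] := @gmulKl sdp_groupoid _ _ gh.
  by exists k; apply: val_inj.
- move=> g h gh; have [k e] := @gmulKr sdp_groupoid _ _ gh.
  by exists k; apply: val_inj.
Defined.

Definition red_incl (g : reduction_groupoid) : sdp_groupoid := val g.

End Reduction.

End SemidirectGroupoids.

Section GraphMorphismAction.
Variables (Q : wqlo_group) (L : pgraph Q).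
Implicit Types (x : graph_morphism L) (m n p q : Q).

Lemma increasing_le (m_ : nat -> Q) (i k : nat) :
  increasing_seq m_ -> (i <= k)%N -> m_ i <=p m_ k.
Proof.
move=> [_ mi]; rewrite leq_eqVlt => /orP[/eqP->|]; last exact: mi.
by exists 1; [exact: pos1|rewrite mulg1].
Qed.

Lemma pdomP x p q :
  pdom x (p, q) <-> [/\ pos p, pos q, p <=p q & pdom x (1, q)].
Proof.
have [[m_ _ ->] _ _ _] := gmapP x; split.
  move=> [i _ [/= Pp Pq pq qm]]; split=> //; exists i => //; split=> //=.
    exact: pos1.
  by exists q => //; rewrite mul1g.
by move=> [Pp Pq pq [i _ [/= _ _ _ qm]]]; exists i.
Qed.

Definition gdom x m : Prop := pdom x (1, m).

Lemma gdom_pos x m : gdom x m -> pos m.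
Proof. by move=> /pdomP[]. Qed.

(* [Omega_seq] lives in [pos `*` pos], and [pos (m * p)] does not imply [pos p],
   whence the test. *)
Definition shift_map x m : Q * Q -> option L := fun pq =>
  if `[< pos pq.1 /\ pos pq.2 >] then x (m * pq.1, m * pq.2) else None.

Lemma shift_mapE x m p q l : shift_map x m (p, q) = Some l <->
  [/\ pos p, pos q & x (m * p, m * q) = Some l].
Proof.
rewrite /shift_map /=; case: ifPn => [/asboolP[Pp Pq]|/asboolPn n]; split=> //.
- by case.
- by move=> [Pp Pq]; exfalso; apply: n.
Qed.

Lemma pdom_shift x m p q : pdom (shift_map x m) (p, q) <->
  [/\ pos p, pos q & pdom x (m * p, m * q)].
Proof.
rewrite /pdom /= /shift_map /=.
case: ifPn => [/asboolP[Pp Pq]|/asboolPn n]; split=> //.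
- by case.
- by move=> [Pp Pq]; exfalso; apply: n.
Qed.

Lemma shift_subproof x m : gdom x m -> is_graph_morphism (shift_map x m).
Proof.
move=> xm; have Pm := gdom_pos xm.
have [[m_ mi em] xu xc xd] := gmapP x; split.
- move: (xm); rewrite /gdom em => -[N _ [/= _ _ _ mN]].
  have mNn (n : nat) : m <=p m_ (N + n)%N.
    by apply: ple_trans mN _; apply: increasing_le => //; exact: leq_addr.
  exists (fun n : nat => m^-1 * m_ (N + n)%N).
    split=> [n|j k jk]; first by have [a Pa <-] := mNn n; rewrite mulKg.
    by apply/(ple_mul2l m); rewrite !mulVKg; apply: mi.2; rewrite ltn_add2l.
  apply/seteqP; split=> -[p q].
    move=> /pdom_shift[Pp Pq]; rewrite em => -[k _ [/= _ _ pq qk]].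
    exists k => //; split=> //=; first exact/(ple_mul2l m).
    apply/(ple_mul2l m); rewrite mulVKg; apply: ple_trans qk _.
    by apply: increasing_le => //; exact: leq_addl.
  move=> [n _ [/= Pp Pq pq qn]]; apply/pdom_shift; split=> //.
  rewrite em; exists (N + n)%N => //; split=> /=.
  + exact: posM.
  + exact: posM.
  + exact/ple_mul2l.
  + by move/(ple_mul2l m): qn; rewrite mulVKg.
- by move=> p q l /shift_mapE[Pp Pq /xu[? ?]]; split; apply/shift_mapE.
- move=> p q r l k /shift_mapE[Pp Pq e1] /shift_mapE[_ Pr e2].
  by apply/shift_mapE; split=> //; exact: xc e1 e2.
- by move=> p q l /shift_mapE[_ _ /xd ->]; rewrite invgM -mulgA mulKg.
Qed.

Definition gact x m (h : gdom x m) : graph_morphism L :=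
  GraphMorphism (shift_subproof h).

Lemma gdom1 x : gdom x 1.
Proof.
have [[m_ mi em] _ _ _] := gmapP x; rewrite /gdom em.
have P1 := @pos1 Q; exists 0%N => //; split=> //=.
  by exists 1; rewrite ?mulg1.
by exists (m_ 0%N); [exact: mi.1|rewrite mul1g].
Qed.

Lemma gact1 x (h : gdom x 1) : gact h = x.
Proof.
apply: graph_morphism_inj => -[p q] /=; rewrite /shift_map /= !mul1g.
case: ifPn => // /asboolPn n; apply: esym; apply: contrapT => xpq.
by have /pdomP[Pp Pq _ _] := xpq; apply: n.
Qed.

Lemma gdomM x m n : pos m -> pos n ->
  gdom x (m * n) <-> exists h : gdom x m, gdom (gact h) n.
Proof.
move=> Pm Pn.
have mmn : m <=p m * n by exists n.
split=> [xmn|[h]].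
  have xm : gdom x m.
    have [[m_ mi em] _ _ _] := gmapP x; move: xmn; rewrite /gdom em.
    move=> [i _ [/= ? _ _ ?]]; exists i => //; split=> //=.
      by exists m => //; rewrite mul1g.
    by apply: ple_trans mmn _.
  exists xm; apply/pdom_shift; split=> //; first exact: pos1.
  by rewrite mulg1; apply/pdomP; split=> //; exact: posM.
by move=> /pdom_shift[_ _]; rewrite mulg1 => /pdomP[].
Qed.

Lemma gactM x m n (h : gdom x m) (hn : gdom (gact h) n)
  (hmn : gdom x (m * n)) : gact hmn = gact hn.
Proof.
apply: graph_morphism_inj => -[p q] /=; rewrite /shift_map /=.
case: ifPn => // /asboolP[Pp Pq]; rewrite /shift_map /= !mulgA ifT //.
by apply/asboolP; split; apply: posM => //; exact: gdom_pos hn.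
Qed.

Lemma gact_directed x m n : gdom x m -> gdom x n ->
  exists l, [/\ gdom x l, m <=p l & n <=p l].
Proof.
have [[m_ mi em] _ _ _] := gmapP x; rewrite /gdom em.
move=> [i _ [/= ? _ _ mi']] [j _ [/= _ _ _ nj]]; exists (m_ (maxn i j)); split.
- exists (maxn i j) => //; split=> //=; first exact: mi.1.
    by exists (m_ (maxn i j)); [exact: mi.1|rewrite mul1g].
  by apply: increasing_le.
- by apply: ple_trans mi' _; apply: increasing_le => //; exact: leq_maxl.
- by apply: ple_trans nj _; apply: increasing_le => //; exact: leq_maxr.
Qed.

Definition graph_morphism_action : directed_action Q :=
  DirectedAction gdom_pos gdom1 gact1 gdomM gactM gact_directed.

End GraphMorphismAction.

Section FilterAction.
Variables (Q : wqlo_group) (L : pgraph Q).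
Implicit Types (x : path_filter L) (m n : Q) (l k : L).

Definition fdom x m : Prop := exists2 l, filter_set x l & deg l = m.

Lemma fdom_pos x m : fdom x m -> pos m.
Proof. by move=> [l _ <-]; exact: deg_pos. Qed.

Lemma filter_deg_inj x k l : filter_set x k -> filter_set x l -> deg k = deg l -> k = l.
Proof.
move=> xk xl dkl; have [_ _ dx] := path_filterP x.
have [j [_ [a ka ea] [b lb eb]]] := dx _ _ xk xl.
have e : k ** a = l ** b by rewrite ea eb.
by have [] := factor_inj ka lb e dkl.
Qed.

Definition fshift x m : set L :=
  [set k | exists l,
    [/\ filter_set x l, deg l = m, src l = rng k & filter_set x (l ** k)]].

Lemma fshiftE x l k : filter_set x l ->
  fshift x (deg l) k <-> src l = rng k /\ filter_set x (l ** k).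
Proof.
move=> xl; split=> [[j [xj dj]]|[lk xlk]].
  by rewrite (filter_deg_inj xj xl dj).
by exists l.
Qed.

Lemma fshift_subproof x m : fdom x m -> is_path_filter (fshift x m).
Proof.
move=> [l xl <-]; have [_ hx dx] := path_filterP x; split.
- by exists (src l); apply/fshiftE => //; rewrite rng_src comp1r.
- move=> j k [a ja <-] /fshiftE-/(_ xl)[].
  rewrite rng_comp // => lj xk; apply/fshiftE => //; split=> //.
  apply: hx xk; exists a; first by rewrite src_comp.
  by rewrite compA.
- move=> j k /fshiftE-/(_ xl)[lj xlj] /fshiftE-/(_ xl)[lk xlk].
  have [i [xi [a ja ea] [b kb eb]]] := dx _ _ xlj xlk.
  rewrite src_comp // in ja; rewrite src_comp // in kb.
  rewrite compA // in ea; rewrite compA // in eb.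
  have lja : src l = rng (j ** a) by rewrite rng_comp.
  have lkb : src l = rng (k ** b) by rewrite rng_comp.
  have e : l ** (j ** a) = l ** (k ** b) by rewrite ea eb.
  have [_ jakb] := factor_inj lja lkb e erefl.
  exists (j ** a); split; last by rewrite jakb; exists b.
    by apply/fshiftE; rewrite // ea.
  by exists a.
Qed.

Definition fact x m (h : fdom x m) : path_filter L :=
  PathFilter (fshift_subproof h).

Lemma fdom1 x : fdom x 1.
Proof.
have [[l xl] hx _] := path_filterP x; exists (rng l); last exact: deg_unit.
apply: hx xl; exists l; first exact: src_rng.
exact: comp1l.
Qed.

Lemma deg1_unit l : deg l = 1 -> l = rng l.
Proof.
move=> dl.
have h1 : src (rng l) = rng l by exact: src_rng.
have h2 : src l = rng (src l) by rewrite rng_src.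
have e : rng l ** l = l ** src l by rewrite comp1l comp1r.
by have [-> _] := factor_inj h1 h2 e (etrans (deg_unit _) (esym dl)).
Qed.

Lemma fact1 x (h : fdom x 1) : fact h = x.
Proof.
apply: path_filter_inj; rewrite /fact /=; have [l xl dl] := h.
rewrite -dl; have lu := deg1_unit dl; have [_ hx dx] := path_filterP x.
apply/seteqP; split=> k.
  move=> /fshiftE-/(_ xl)[lk]; rewrite lu src_rng in lk *.
  by rewrite lk comp1l.
move=> xk; have [j [_ [a la ea] [b kb eb]]] := dx _ _ xl xk.
apply/fshiftE => //.
have lk : rng l = rng k by rewrite -(rng_comp la) ea -eb rng_comp.
by rewrite lu src_rng lk comp1l.
Qed.

Lemma fdomM x m n : pos m -> pos n ->
  fdom x (m * n) <-> exists h : fdom x m, fdom (fact h) n.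
Proof.
move=> Pm Pn; have [_ hx _] := path_filterP x; split.
  move=> [l xl dl].
  have [[j k] [[/= jk ejk dj dk] _]] := unique_factorisation Pm Pn dl.
  have xj : filter_set x j by apply: hx xl; exists k.
  have xm : fdom x m by exists j.
  by exists xm; exists k => //=; rewrite -dj; apply/fshiftE; rewrite // ejk.
move=> [h [k /= [l [xl dl lk xlk]] dk]].
by exists (l ** k) => //; rewrite deg_comp // dl dk.
Qed.

Lemma factM x m n (h : fdom x m) (hn : fdom (fact h) n)
  (hmn : fdom x (m * n)) : fact hmn = fact hn.
Proof.
apply: path_filter_inj => /=; have [l xl dl] := h; have [k xk dk] := hn.
subst m n; have /(fshiftE _ xl)[lk xlk] := xk.
rewrite -deg_comp //; apply/seteqP; split=> j.
  move=> /(fshiftE _ xlk)[]; rewrite src_comp // => kj; rewrite compA // => xlkj.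
  apply/(@fshiftE (fact h)) => //; split=> //.
  by apply/(fshiftE _ xl); rewrite rng_comp.
move=> /(@fshiftE (fact h) _ _ xk)[kj] /(fshiftE _ xl)[_ xlkj].
by apply/(fshiftE _ xlk); rewrite src_comp // compA.
Qed.

Lemma fact_directed x m n : fdom x m -> fdom x n ->
  exists p, [/\ fdom x p, m <=p p & n <=p p].
Proof.
have [_ _ dx] := path_filterP x.
move=> [l xl <-] [k xk <-]; have [j [xj lj kj]] := dx _ _ xl xk.
by exists (deg j); split; [exists j|exact: mle_deg|exact: mle_deg].
Qed.

Definition filter_action : directed_action Q :=
  DirectedAction fdom_pos fdom1 fact1 fdomM factM fact_directed.

End FilterAction.

Section PathGroupoids.
Variables (Q : wqlo_group) (L : pgraph Q).

Local Notation Xm := (graph_morphism_action L).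
Local Notation Xf := (filter_action L).

Definition boundary_gm : set Xm :=
  [set x : graph_morphism L | forall m l (E : set L),
    x (1, m) = Some l -> finite_set E -> exhaustive E ->
    (@rng L @` E) (src l) ->
    exists2 n, E n & x (m, m * deg n) = Some n].

Definition boundary_filter : set Xf :=
  closure [set x : path_filter L | ultrafilter x].

Definition gm_groupoid : top_groupoid := sdp_groupoid Xm.
Definition filter_groupoid : top_groupoid := sdp_groupoid Xf.
Definition boundary_gm_groupoid : top_groupoid := reduction_groupoid boundary_gm.
Definition boundary_filter_groupoid : top_groupoid := reduction_groupoid boundary_filter.

End PathGroupoids.

Arguments boundary_gm {Q} L.
Arguments boundary_filter {Q} L.

(* Main.v *)
(* A graph morphism [x] is recovered from its hull: [x (p, q)] is the path [k] such
   that [l ** k] is in the hull for the prefix [l] of degree [p].  As [L] is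
   countable, every filter has a cofinal chain, whose degrees define the domain of
   a graph morphism with that hull.  Hence the hull is an equivariant
   homeomorphism, and it induces the isomorphism of semidirect products.
   It carries the boundary of graph morphisms to the set of filters [x] that
   contain, for each [l] in [x] and each finite exhaustive [E] starting at
   [src l], some [l ** n] with [n] in [E].  This condition is closed; ultrafilters
   satisfy it, because in a finitely aligned category a path compatible with
   all elements of an ultrafilter belongs to it; conversely, any such filter is a
   limit of ultrafilters, since the minimal extensions of [l] by
   finitely many paths outside the filter cannot be exhaustive. *)
Require Import Defs.
From mathcomp Require Import all_boot all_classical topology.

Set Implicit Arguments.
Unset Strict Implicit.
Unset Printing Implicit Defensive.

Local Open Scope classical_set_scope.
Local Open Scope group_scope.

(** * The topology of a semidirect product groupoid *)

Section SemidirectTopology.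
Variables (Q : wqlo_group) (X : directed_action Q).

Lemma sdp_basics_open (B : set (sdp X)) : sdp_basics B -> open B.
Proof.
move=> bB; exists [set B]; last by rewrite bigcup_set1.
by move=> _ ->; apply: (@finI_from1 _ _ _ id).
Qed.

(** Open sets are unions of finite intersections of sets from [sdp_basics], and preimages commute
    with both operations. *)
Lemma sdp_continuous (S : topologicalType) (f : S -> sdp X) :
  (forall B, sdp_basics B -> open (f @^-1` B)) -> continuous f.
Proof.
move=> fB; apply/continuousP => _ [D' D'b <-].
rewrite preimage_bigcup; apply: bigcup_open => _ /D'b[F Fb <-].
rewrite /= preimage_bigcap bigcap_fset big_seq; elim/big_ind: _ => //.
- exact: openT.
- by move=> A B; exact: openI.
- by move=> A /Fb /set_mem /fB.
Qed.

End SemidirectTopology.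

(** * Functoriality of the semidirect product and its reductions *)

Section SemidirectMaps.
Variable Q : wqlo_group.

(** Equivariance is stated through [act_eq], which is all that the elements and basic sets of [sdp]
    see of the action. *)
Definition act_morphism (X Y : directed_action Q) (h : X -> Y) : Prop :=
  forall x m y n, act_eq x m y n -> act_eq (h x) m (h y) n.

Section Map.
Variables (X Y : directed_action Q) (h : X -> Y) (hM : act_morphism h).

Lemma sdp_map_subproof (g : sdp X) :
  in_sdp (h (sdp_rng g)) (sdp_coc g) (h (sdp_src g)).
Proof. by have [m [n [Pm Pn -> e]]] := sdpP g; exists m, n; split=> //; exact: hM. Qed.

Definition sdp_map (g : sdp X) : sdp Y := Sdp (sdp_map_subproof g).

Lemma sdp_map_mul (g k : sdp X) (gk : sdp_composable g k)
  (fgk : sdp_composable (sdp_map g) (sdp_map k)) :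
  sdp_map (sdp_mul gk) = sdp_mul fgk.
Proof. exact: sdp_inj. Qed.

Lemma sdp_map_inv (g : sdp X) : sdp_map (sdp_inv g) = sdp_inv (sdp_map g).
Proof. exact: sdp_inj. Qed.

Lemma sdp_map_reduction (U : set X) (V : set Y) (g : reduction U) :
  (forall x, U x -> V (h x)) -> sdp_map (val g) \in reduction V.
Proof.
by move=> UV; have /set_mem[Ur Us] := valP g; apply/mem_set; split; exact: UV.
Qed.

Definition red_map (U : set X) (V : set Y) (UV : forall x, U x -> V (h x))
  (g : reduction U) : reduction V :=
  exist _ (sdp_map (val g)) (sdp_map_reduction g UV).

Lemma red_map_continuous U V (UV : forall x, U x -> V (h x)) :
  continuous sdp_map -> continuous (red_map UV).
Proof.
move=> /continuousP hc; apply/continuousP => _ [B oB <-].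
by exists (sdp_map @^-1` B) => //; exact: hc.
Qed.

End Map.

Variables (X Y : directed_action Q) (h : X -> Y) (k : Y -> X).
Hypotheses (hM : act_morphism h) (kM : act_morphism k).
Hypothesis (hK : cancel h k).

Lemma sdp_mapK : cancel (sdp_map hM) (sdp_map kM).
Proof. by move=> g; apply: sdp_inj; rewrite //= hK. Qed.

(** The preimage of a basic set is again basic: [kM] and [hK] pull its equation [act_eq] back to
    [X]. *)
Lemma sdp_map_continuous : continuous h -> continuous (sdp_map hM).
Proof.
move=> /continuousP hc; apply: sdp_continuous.
move=> _ [m [n [U [V [Pm Pn oU oV ->]]]]]; apply: sdp_basics_open.
exists m, n, (h @^-1` U), (h @^-1` V); split=> //; [exact: hc|exact: hc|].
apply/seteqP; split=> g [Ug Vg eg eqg]; split=> //; last exact: hM.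
by have := kM eqg; rewrite /= !hK.
Qed.

End SemidirectMaps.

(** * Equivariant homeomorphisms induce groupoid isomorphisms *)

Section SemidirectIsomorphism.
Variables (Q : wqlo_group) (X Y : directed_action Q) (h : X -> Y) (k : Y -> X).
Hypotheses (hM : act_morphism h) (kM : act_morphism k).
Hypotheses (hK : cancel h k) (kK : cancel k h).
Hypotheses (hc : continuous h) (kc : continuous k).

Lemma sdp_map_isomorphism :
  groupoid_isomorphism (sdp_map hM : sdp_groupoid X -> sdp_groupoid Y).
Proof.
split.
- exists (sdp_map kM); split.
  + exact: sdp_mapK.
  + exact: sdp_mapK.
  + exact: (sdp_map_continuous kM hK hc).
  + exact: (sdp_map_continuous hM kK kc).
- move=> g g'; split; rewrite /= /sdp_composable /=; first by move=> ->.
  by move/(can_inj hK).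
- by move=> g g' gg' fgg'; exact: sdp_map_mul.
- by move=> g; exact: sdp_map_inv.
Qed.

Lemma red_map_isomorphism (U : set X) (V : set Y)
  (UV : forall x, U x -> V (h x)) (VU : forall y, V y -> U (k y)) :
  groupoid_isomorphism (red_map hM UV : reduction_groupoid U -> reduction_groupoid V).
Proof.
have [_ ec em ei] := sdp_map_isomorphism; split.
- exists (red_map kM VU); split.
  + by move=> g; apply: val_inj; exact: sdp_mapK.
  + by move=> g; apply: val_inj; exact: sdp_mapK.
  + by apply: red_map_continuous; exact: (sdp_map_continuous kM hK hc).
  + by apply: red_map_continuous; exact: (sdp_map_continuous hM kK kc).
- by move=> g g'; exact: (ec (val g) (val g')).
- by move=> g g' gg' fgg'; apply: val_inj; exact: em.
- by move=> g; apply: val_inj; exact: ei.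
Qed.

End SemidirectIsomorphism.

(** * Filters, chains and ultrafilters of a small category *)

Section Categories.
Variable L : small_category.
Implicit Types (l m n k : L) (E K : set L) (x y : Defs.path_filter L).

Lemma mle_refl l : mle l l.
Proof. by exists (src l); rewrite ?rng_src ?comp1r. Qed.

Lemma mle_trans l m n : mle l m -> mle m n -> mle l n.
Proof.
move=> [a la <-] [b]; rewrite src_comp // => ab <-.
by exists (a ** b); rewrite ?rng_comp // -Defs.compA.
Qed.

Lemma mle_comp l m : src l = rng m -> mle l (l ** m).
Proof. by exists m. Qed.

Lemma mle_rng l m : mle l m -> rng m = rng l.
Proof. by move=> [a la <-]; rewrite rng_comp. Qed.

Lemma mle_compl l m n : src l = rng m -> mle m n -> mle (l ** m) (l ** n).
Proof. by move=> lm [a ma <-]; exists a; rewrite ?src_comp // Defs.compA. Qed.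

Lemma filter_mle x l m : mle l m -> filter_set x m -> filter_set x l.
Proof. by have [_ hx _] := path_filterP x; exact: hx. Qed.

Lemma filter_directed x l m : filter_set x l -> filter_set x m ->
  exists k, [/\ filter_set x k, mle l k & mle m k].
Proof. by have [_ _ dx] := path_filterP x; exact: dx. Qed.

Lemma filter_nonempty x : exists l, filter_set x l.
Proof. by have [[l xl] _ _] := path_filterP x; exists l. Qed.

(** Pick one path of [x] per index; directedness bounds these finitely many paths within [x], and
    each [R i] passes to the bound. *)
Lemma filter_finite_bound x (I : Type) (E : set I) (R : I -> set L) :
  (forall i l m, mle l m -> R i l -> R i m) -> finite_set E ->
  (forall i, E i -> exists2 l, filter_set x l & R i l) ->
  exists2 l, filter_set x l & forall i, E i -> R i l.
Proof.
(* A choice structure on [I] lets [E] be enumerated by a sequence. *)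
elim/Pchoice: I => I in E R *.
move=> Rle /finite_seqP[s ->]; elim: s => [|i s IH] Rs.
  by have [l xl] := filter_nonempty x; exists l.
have [|l xl ls] := IH; first by move=> j js; apply: Rs; rewrite /= inE js orbT.
have [m xm im] := Rs i (mem_head i s).
have [k [xk lk mk]] := filter_directed xl xm.
exists k => // j /=; rewrite inE => /predU1P[->|js]; first exact: Rle im.
exact: Rle (ls _ js).
Qed.

(** Otherwise each [k] in [E] is incompatible with some path of [x]; incompatibility passes to
    extensions, so a common bound in [x] is incompatible with all of [E]. *)
Lemma filter_compatible_pigeonhole x E : finite_set E ->
  (forall l, filter_set x l -> exists2 k, E k & ideal k `&` ideal l !=set0) ->
  exists2 k, E k & forall l, filter_set x l -> ideal k `&` ideal l !=set0.
Proof.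
move=> fE Ex; apply: contrapT => nE.
have [|//|k Ek|l xl El] :=
  @filter_finite_bound x L E (fun k l => ~ (ideal k `&` ideal l !=set0)).
- by move=> k l m lm + [n [kn mn]]; apply; exists n; split=> //; exact: mle_trans mn.
- apply: contrapT => nk; apply: nE; exists k => // l xl.
  by apply: contrapT => kl; apply: nk; exists l.
by have [k /El] := Ex _ xl.
Qed.

Lemma chain_le (c : nat -> L) (i j : nat) :
  (forall i : nat, mle (c i) (c i.+1)) -> (i <= j)%N -> mle (c i) (c j).
Proof.
move=> cS; elim: j => [|j IH]; first by rewrite leqn0 => /eqP ->; exact: mle_refl.
rewrite leq_eqVlt => /predU1P[->|/IH cij]; first exact: mle_refl.
exact: mle_trans (cS j).
Qed.

Lemma chain_filter (c : nat -> L) : (forall i : nat, mle (c i) (c i.+1)) ->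
  is_path_filter [set l | exists i, mle l (c i)].
Proof.
move=> cS; split; first by exists (c 0%N); exists 0%N; exact: mle_refl.
- by move=> l m lm [i mi]; exists i; exact: mle_trans mi.
- move=> l m [i li] [j mj]; exists (c (maxn i j)); split.
  + by exists (maxn i j); exact: mle_refl.
  + by apply: mle_trans li _; apply: chain_le => //; exact: leq_maxl.
  + by apply: mle_trans mj _; apply: chain_le => //; exact: leq_maxr.
Qed.

(* Countability lets every requirement [R e] be met by one step of a chain
   inside [P]. *)
Lemma chain_meeting (P : set L) (R : L -> L -> L -> Prop) l0 :
  countable [set: L] -> P l0 ->
  (forall e l, P l -> exists m, [/\ P m, mle l m & R e l m]) ->
  exists c : nat -> L, [/\ c 0%N = l0, forall i, P (c i),
    forall i, mle (c i) (c i.+1) & forall e, exists i, R e (c i) (c i.+1)].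
Proof.
move=> /countable_injP[f finj] P0 PR.
(* Step [i] serves the only [e] with code [i], if any. The guard [P l] makes the choice total;
   outside [P], [l] is a default value. *)
have step (i : nat) (l : L) : exists m, P l ->
    [/\ P m, mle l m & forall e, f e = i -> R e l m].
  have [Pl|nPl] := pselect (P l); last by exists l.
  have [[e fe]|ne] := pselect (exists e, f e = i).
    have [m [Pm lm Rm]] := PR e l Pl.
    exists m => _; split=> // e' fe'.
    by have <- : e = e' by apply: finj; rewrite ?inE // fe fe'.
  exists l => _; split=> //; first exact: mle_refl.
  by move=> e fe; exfalso; apply: ne; exists e.
have /choice[g gP] : forall il : nat * L, exists m, P il.2 ->
    [/\ P m, mle il.2 m & forall e, f e = il.1 -> R e il.2 m].
  by move=> [i l]; exact: step.
pose c := fix c (i : nat) : L := if i is j.+1 then g (j, c j) else l0.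
have Pc (i : nat) : P (c i) by elim: i => //= i IH; have [] := gP (i, c i) IH.
exists c; split=> // [i|e]; first by have [] := gP (i, c i) (Pc i).
by exists (f e); have [_ _] := gP (f e, c (f e)) (Pc _); exact.
Qed.

Lemma filter_chain x : countable [set: L] ->
  exists c : nat -> L, [/\ forall i, filter_set x (c i), forall i, mle (c i) (c i.+1)
    & forall l, filter_set x l -> exists i, mle l (c i)].
Proof.
move=> cL; have [l0 xl0] := filter_nonempty x.
have [|c [_ xc cS cE]] :=
  @chain_meeting x (fun e _ m => filter_set x e -> mle e m) l0 cL xl0.
- move=> e l xl; have [xe|nxe] := pselect (filter_set x e); last first.
    by exists l; split=> //; exact: mle_refl.
  by have [k [xk lk ek]] := filter_directed xl xe; exists k.
- by exists c; split=> // l xl; have [i ci] := cE l; exists i.+1; exact: ci.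
Qed.

(** Each [e] has a step at which the chain passes above [e] if [e] is compatible with the current
    path. An element of a larger filter is compatible with the whole chain, hence absorbed by it. *)
Lemma ultrafilter_exists l : countable [set: L] ->
  exists2 x : Defs.path_filter L, ultrafilter x & filter_set x l.
Proof.
move=> cL; have [||c [c0 _ cS cE]] :=
  @chain_meeting setT (fun e k m => ideal k `&` ideal e !=set0 -> mle e m) l cL.
- by [].
- move=> e k _; have [[m [km em]]|n] := pselect (ideal k `&` ideal e !=set0).
    by exists m.
  by exists k; split=> //; exact: mle_refl.
exists (PathFilter (chain_filter cS)); last by exists 0%N; rewrite c0; exact: mle_refl.
move=> y xy; apply: path_filter_inj; apply/seteqP; split=> //= e ye.
have [i ei] := cE e; exists i.+1; apply: ei.
have yc : filter_set y (c i) by apply: xy; exists i; exact: mle_refl.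
by have [k [_ ck ek]] := filter_directed yc ye; exists k.
Qed.

(** [E] collects the suffixes after [l] of the finite sets that finite alignment provides for [l]
    and each [k] in [K]. *)
Lemma minimal_extensions l K : finitely_aligned L -> finite_set K ->
  exists E, [/\ finite_set E,
    forall n, E n -> src l = rng n /\ exists2 k, K k & mle k (l ** n)
  & forall k m, K k -> mle l m -> mle k m -> exists2 n, E n & mle (l ** n) m].
Proof.
move=> La fK; have /choice[J JP] : forall k, exists J : set L, finite_set J /\
    ideal l `&` ideal k = \bigcup_(j in J) ideal j.
  by move=> k; have [J fJ eJ] := La l k; exists J.
have /choice[f fP] : forall m, exists n, mle l m -> src l = rng n /\ l ** n = m.
  move=> m; have [[n ln e]|nm] := pselect (mle l m); first by exists n.
  by exists m.
have JI k j : J k j -> mle l j /\ mle k j.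
  move=> Jj; suff : (ideal l `&` ideal k) j by [].
  by rewrite (JP k).2; exists j => //; exact: mle_refl.
exists (f @` \bigcup_(k in K) J k); split.
- by apply/finite_image/bigcup_finite => // k _; exact: (JP k).1.
- move=> _ [j [k Kk /JI[lj kj]] <-]; have [lf e] := fP j lj.
  by split=> //; exists k; rewrite // e.
- move=> k m Kk lm km; have : (ideal l `&` ideal k) m by [].
  rewrite (JP k).2 => -[j Jj jm]; have [lj kj] := JI _ _ Jj.
  by exists (f j); [exists j => //; exists k|rewrite (fP j lj).2].
Qed.

(* Failing this, each of the finitely many minimal common extensions of [k] and
   [l] would be incompatible with some element of [x]; a common bound in [x] of
   these elements and [l] is compatible with [k], a contradiction. *)
Lemma compatible_extension x k l : finitely_aligned L ->
  (forall m, filter_set x m -> ideal k `&` ideal m !=set0) -> filter_set x l ->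
  exists n, [/\ mle k n, mle l n &
    forall m, filter_set x m -> ideal n `&` ideal m !=set0].
Proof.
move=> La kx xl; have [J fJ eJ] := La k l.
have [m xm|n Jn nx] := @filter_compatible_pigeonhole x J fJ.
  have [p [xp mp lp]] := filter_directed xm xl.
  have [q [kq pq]] := kx p xp.
  have : (ideal k `&` ideal l) q by split=> //; exact: mle_trans pq.
  rewrite eJ => -[j Jj jq]; exists j => //; exists q; split=> //.
  exact: mle_trans pq.
exists n; suff [] : (ideal k `&` ideal l) n by [].
by rewrite eJ; exists n => //; exact: mle_refl.
Qed.

(** A chain from [k] through paths compatible with [x] can pass above every element of [x]; its
    filter contains [x] and [k], so it is [x] by maximality. *)
Lemma ultrafilter_compatible x k : finitely_aligned L -> countable [set: L] ->
  ultrafilter x -> (forall l, filter_set x l -> ideal k `&` ideal l !=set0) ->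
  filter_set x k.
Proof.
move=> La cL ux kx; pose P := [set n | forall m, filter_set x m ->
  ideal n `&` ideal m !=set0].
have [e l Pl|c [c0 _ cS cE]] :=
    @chain_meeting P (fun e _ m => filter_set x e -> mle e m) k cL kx.
  have [xe|nxe] := pselect (filter_set x e); last first.
    by exists l; split=> //; exact: mle_refl.
  by have [n [ln en nx]] := compatible_extension La Pl xe; exists n.
rewrite (ux (PathFilter (chain_filter cS))).
  by exists 0%N; rewrite c0; exact: mle_refl.
by move=> l xl; have [i ci] := cE l; exists i.+1; exact: ci.
Qed.

Lemma cylinder_open K1 K2 : finite_set K1 -> finite_set K2 ->
  open (cylinder (@filter_set L) K1 K2).
Proof.
move=> fK1 fK2; exists [set cylinder (@filter_set L) K1 K2].
  by move=> _ ->; exists K1, K2.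
by rewrite bigcup_set1.
Qed.

Lemma closure_filterP (A : set (Defs.path_filter L)) x : closure A x <->
  forall K1 K2, finite_set K1 -> finite_set K2 ->
    cylinder (@filter_set L) K1 K2 x -> A `&` cylinder (@filter_set L) K1 K2 !=set0.
Proof.
split=> [Ax K1 K2 fK1 fK2 xK|Ax B].
  by apply: Ax; apply: open_nbhs_nbhs; split=> //; exact: cylinder_open.
rewrite nbhsE => -[_ [[D Dc <-] [C DC Cx]] DB].
have [K1 [K2 [fK1 fK2 e]]] := Dc _ DC.
have [|y [Ay Ky]] := Ax K1 K2 fK1 fK2; first by rewrite -e.
by exists y; split=> //; apply: DB; exists C => //; rewrite e.
Qed.

End Categories.

(** * The boundary of the filter space through exhaustive sets *)

Section FilterBoundary.
Variables (Q : wqlo_group) (L : pgraph Q).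
Hypothesis La : finitely_aligned L.
Implicit Types (l m n k : L) (E K : set L) (x y : Defs.path_filter L).

Lemma mle_cancel l m n : src l = rng m -> src l = rng n ->
  mle (l ** m) (l ** n) -> mle m n.
Proof.
move=> lm ln [a]; rewrite src_comp // => ma; rewrite Defs.compA // => e.
have lma : src l = rng (m ** a) by rewrite rng_comp.
by have [_ <-] := Defs.factor_inj lma ln e erefl; exists a.
Qed.

(** The condition of [boundary_gm], read on the hull. *)
Definition meets_exhaustive x : Prop := forall l E, filter_set x l ->
  finite_set E -> exhaustive E -> (@rng L @` E) (src l) ->
  exists2 n, E n & src l = rng n /\ filter_set x (l ** n).

(** Take the suffixes from [minimal_extensions]. Some extension of [l ** m] lies above an element of
    [E], hence above some [l ** n] with [n] in [E']; cancelling [l] makes [m] and [n] compatible. *)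
Lemma exhaustive_extensions l E : finite_set E -> exhaustive E ->
  (@rng L @` E) (rng l) -> exists E', [/\ finite_set E', exhaustive E',
    (@rng L @` E') (src l)
  & forall n, E' n -> src l = rng n /\ exists2 k, E k & mle k (l ** n)].
Proof.
move=> fE exE El; have [E' [fE' E'E E'm]] := minimal_extensions l La fE.
have ex m : src l = rng m -> exists2 n, E' n & ideal m `&` ideal n !=set0.
  move=> lm; have [|k Ek [p [[a]]]] := exE (l ** m); first by rewrite rng_comp.
  rewrite src_comp // => ma <-; rewrite Defs.compA // => kp.
  have lma : src l = rng (m ** a) by rewrite rng_comp.
  have [n E'n np] := E'm k _ Ek (mle_comp lma) kp; exists n => //.
  exists (m ** a); split; first exact: mle_comp.
  by apply: mle_cancel np => //; have [] := E'E n E'n.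
exists E'; split=> //.
- move=> m [n E'n nm]; apply: ex; rewrite -nm.
  by have [] := E'E n E'n.
- have [|n E'n _] := ex (src l); first by rewrite rng_src.
  by exists n => //; have [->] := E'E n E'n.
Qed.

(** Each [m] in [x] has a bound [l ** a] in [x], and [a] is compatible with some [n] in [E], so [m]
    is compatible with [l ** n]. By pigeonhole one [l ** n] is compatible with all of [x]. *)
Lemma ultrafilter_meets_exhaustive x : ultrafilter x -> meets_exhaustive x.
Proof.
move=> ux l E xl fE exE El.
pose E' := [set k | exists2 n, E n & src l = rng n /\ l ** n = k].
suff [_ [n En [ln <-]] kx] : exists2 k, E' k & forall m, filter_set x m ->
    ideal k `&` ideal m !=set0.
  exists n => //; split=> //.
  by apply: (ultrafilter_compatible La _ ux kx); exact: pgraph_countable.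
apply: filter_compatible_pigeonhole.
  apply: (@sub_finite_set _ _ (cat_comp l @` E)); last exact: finite_image.
  by move=> _ [n En [_ <-]]; exists n.
move=> m xm; have [k [xk mk [a la ea]]] := filter_directed xm xl.
have [|n En [p [[b ab <-] np]]] := exE a; first by rewrite -la.
have ln : src l = rng n by rewrite -(mle_rng np) rng_comp.
have lab : src l = rng (a ** b) by rewrite rng_comp.
exists (l ** n); first by exists n.
exists (l ** (a ** b)); split; first exact: mle_compl.
by apply: mle_trans mk _; rewrite -ea -Defs.compA //; apply: mle_comp; rewrite src_comp.
Qed.

(** If [x] fails at [l] and [E], so does every filter in the cylinder of those that contain [l] and
    avoid the finitely many [l ** n]. *)
Lemma meets_exhaustive_closed x :
  closure [set y | meets_exhaustive y] x -> meets_exhaustive x.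
Proof.
move=> /closure_filterP xB l E xl fE exE El; apply: contrapT => nE.
pose K := [set k | exists2 n, E n & src l = rng n /\ l ** n = k].
have fK : finite_set K.
  apply: (@sub_finite_set _ _ (cat_comp l @` E)); last exact: finite_image.
  by move=> _ [n En [_ <-]]; exists n.
have [|y [yB [ly yK]]] := xB [set l] K (finite_set1 l) fK.
  split=> [_ ->//|k xk [n En [ln e]]]; apply: nE; exists n => //.
  by rewrite e.
have [|n En [ln yn]] := yB l E _ fE exE El; first exact: ly.
by apply: (yK _ yn); exists n.
Qed.

(* The minimal extensions of [l] by the finitely many excluded paths do not form
   an exhaustive set, as [x] meets every exhaustive set; any ultrafilter through
   an extension of [l] that avoids them approximates [x]. *)
Lemma meets_exhaustive_closure x : meets_exhaustive x ->
  closure [set y : Defs.path_filter L | ultrafilter y] x.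
Proof.
move=> xB; apply/closure_filterP => K1 K2 fK1 fK2 [K1x xK2].
have [|//|k /K1x xk|l xl K1l] :=
    @filter_finite_bound _ x L K1 (fun k l => mle k l).
- by move=> i j k jk ij; exact: mle_trans jk.
- by exists k => //; exact: mle_refl.
have [E [fE EK Em]] := minimal_extensions l La fK2.
have [m lm mE] : exists2 m, src l = rng m &
    forall n, E n -> ~ (ideal m `&` ideal n !=set0).
  apply: contrapT => nm.
  have ex m : src l = rng m -> exists2 n, E n & ideal m `&` ideal n !=set0.
    move=> lm; apply: contrapT => nE; apply: nm; exists m => // n En mn.
    by apply: nE; exists n.
  have [||n En [ln xn]] := xB l E xl fE.
  - move=> m [n En nm']; apply: ex; rewrite -nm'.
    by have [] := EK n En.
  - have [|n En _] := ex (src l); first by rewrite rng_src.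
    by exists n => //; have [->] := EK n En.
  have [_ [k K2k kn]] := EK n En.
  by apply: (xK2 k) => //; exact: filter_mle xn.
have [y uy ylm] := ultrafilter_exists (l ** m) (pgraph_countable L).
exists y; split=> //; split=> k.
  move=> /K1l kl; apply: filter_mle ylm; apply: mle_trans kl _.
  exact: mle_comp.
(* A common extension of [l ** m] and an excluded [k] would lie above some [l ** n] with [n] in [E],
   making [m] and [n] compatible. *)
move=> yk K2k; have [p [yp lmp kp]] := filter_directed ylm yk.
have lp : mle l p by apply: mle_trans lmp; exact: mle_comp.
have [n En np] := Em k p K2k lp kp; apply: (mE n En).
have [a la ea] := lp; subst p; have [ln _] := EK n En.
by exists a; split; [apply: mle_cancel lmp|apply: mle_cancel np].
Qed.

Lemma boundary_filterE :
  boundary_filter L = [set x : Defs.path_filter L | meets_exhaustive x].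
Proof.
apply/seteqP; split=> x; last exact: meets_exhaustive_closure.
move=> xB; apply: meets_exhaustive_closed; apply: closureS xB => y.
exact: ultrafilter_meets_exhaustive.
Qed.

(** Equal shifts mean that [p ** c] is in [x] exactly when [q ** c] is in [y]. Extend [k] in [x] to
    [p ** a = k ** b], use the condition on [y] at [q ** a], and return to [x]. *)
Lemma boundary_filter_invariant : act_invariant (boundary_filter L).
Proof.
rewrite boundary_filterE => x y m n yB [hm [hn hmn]] k E xk fE exE Ek.
have [p xp pm] := hm; have [q yq qn] := hn.
have shiftE l : src p = rng l /\ filter_set x (p ** l) <->
    src q = rng l /\ filter_set y (q ** l).
  move: (congr1 (@filter_set L) hmn); rewrite /= -pm -qn => e.
  by rewrite -(fshiftE _ xp) -(fshiftE _ yq) e.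
have [j [xj [a pa ea] [b kb eb]]] := filter_directed xp xk.
have [qa yqa] : src q = rng a /\ filter_set y (q ** a).
  by apply/shiftE; rewrite ea.
have sab : src a = src b by rewrite -(src_comp pa) -(src_comp kb) ea eb.
(* [E] starts at the source of [k]; moving it along [b] yields an exhaustive set at the source of
   [q ** a]. *)
have [|E' [fE' exE' E'b E'E]] := exhaustive_extensions fE exE (l := b).
  by rewrite -kb.
have [|i E'i [qai yqai]] := yB (q ** a) E' yqa fE' exE'.
  by rewrite src_comp // sab.
rewrite src_comp // in qai; rewrite Defs.compA // in yqai.
have [pai xpai] : src p = rng (a ** i) /\ filter_set x (p ** (a ** i)).
  by apply/shiftE; rewrite rng_comp.
have [bi [e Ee ebi]] := E'E i E'i.
have ke : src k = rng e by rewrite kb -(mle_rng ebi) rng_comp.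
exists e => //; split=> //; apply: filter_mle xpai.
by rewrite -Defs.compA // ea -eb Defs.compA //; exact: mle_compl.
Qed.

End FilterBoundary.

(** * The equivariant homeomorphism between graph morphisms and filters *)

Section Hull.
Variables (Q : wqlo_group) (L : pgraph Q).
Implicit Types (x y : graph_morphism L) (F : Defs.path_filter L).
Implicit Types (l m n k : L) (p q : Q).

(** The possible values at [(p, q)] of a graph morphism with hull [A]. *)
Definition segment (A : set L) (p q : Q) : set L := [set k | exists l,
  [/\ deg l = p, src l = rng k, A (l ** k) & q = p * deg k]].

Lemma hullP x l : hull x l <-> x (1, deg l) = Some l.
Proof.
split=> [[[p q] [_ /= ->] e]|e].
  by have [_ _ _ xd] := gmapP x; move: (xd _ _ _ e); rewrite invg1 mul1g => ->.
by exists (1, deg l) => //; split=> //; rewrite /pdom /= e.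
Qed.

Lemma gm_composable x p q r l m :
  x (p, q) = Some l -> x (q, r) = Some m -> src l = rng m.
Proof.
by have [_ xu _ _] := gmapP x => /xu[_ ql] /xu[]; rewrite ql => -[].
Qed.

Lemma pdom_value x p q :
  pdom x (p, q) -> exists2 l, x (p, q) = Some l & deg l = p^-1 * q.
Proof.
have [_ _ _ xd] := gmapP x; rewrite /pdom /=.
by case e : (x (p, q)) => [l|//] _; exists l => //; exact: xd.
Qed.

Lemma gdom_value x q : gdom x q -> exists2 l, x (1, q) = Some l & deg l = q.
Proof. by move=> /pdom_value; rewrite invg1 mul1g. Qed.

(** Composing [x (1, p)] with [x (p, q)] gives a path of the hull; unique factorisation recovers
    [x (p, q)] from it. *)
Lemma gm_segment x p q k : x (p, q) = Some k <-> segment (hull x) p q k.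
Proof.
have [_ xu xc xd] := gmapP x; split=> [e|[l [<- lk /hullP e ->]]].
  have /pdomP[Pp Pq [a Pa ea] xq] : pdom x (p, q) by rewrite /pdom /= e.
  rewrite -ea in xq; have [xp _] := (gdomM x Pp Pa).1 xq.
  have [l el dl] := gdom_value xp; have dk := xd _ _ _ e.
  have lk := gm_composable el e.
  exists l; split=> //; last by rewrite dk mulVKg.
  by apply/hullP; rewrite deg_comp // dl dk mulVKg; exact: xc el e.
rewrite deg_comp // in e.
have Pl := deg_pos l; have Pk := deg_pos k.
have xlk : gdom x (deg l * deg k) by rewrite /gdom /pdom /= e.
have [xl _] := (gdomM x Pl Pk).1 xlk.
have [u eu du] := gdom_value xl.
have [|v ev dv] := @pdom_value x (deg l) (deg l * deg k).
  by apply/pdomP; split=> //; [exact: posM|exists (deg k)].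
have [uvlk] : Some (u ** v) = Some (l ** k) by rewrite -e -(xc _ _ _ _ _ eu ev).
by have [_ vk] := Defs.factor_inj (gm_composable eu ev) lk uvlk du; rewrite ev vk.
Qed.

Lemma gm_hull_inj x y : hull x = hull y -> x = y.
Proof.
move=> exy; have xy p q k : x (p, q) = Some k <-> y (p, q) = Some k.
  by rewrite !gm_segment exy.
apply: graph_morphism_inj => -[p q]; case ey : (y (p, q)) => [k|].
  exact/xy.
by case ex : (x (p, q)) => [k|//]; move/xy: ex; rewrite ey.
Qed.

(** The missing factor is [x (deg l, deg m)]. *)
Lemma hull_mle x l m : hull x l -> hull x m -> deg l <=p deg m -> mle l m.
Proof.
move=> /hullP xl /hullP xm lm; have [_ _ xc _] := gmapP x.
have [|a xa da] := @pdom_value x (deg l) (deg m).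
  by apply/pdomP; rewrite /pdom /= xm; split=> //; exact: deg_pos.
exists a; first exact: gm_composable xl xa.
by have := xc _ _ _ _ _ xl xa; rewrite xm => -[].
Qed.

Lemma hull_subproof x : is_path_filter (hull x).
Proof.
have [_ _ xc _] := gmapP x; split.
- have [l xl dl] := gdom_value (@gdom1 _ _ x).
  by exists l; apply/hullP; rewrite dl.
- move=> l m [a la <-] xla.
  have ea : x (deg l, deg l * deg a) = Some a by apply/gm_segment; exists l.
  have xd : gdom x (deg l * deg a).
    by move/hullP: xla; rewrite deg_comp // /gdom /pdom /= => ->.
  have [xl _] := (gdomM x (deg_pos l) (deg_pos a)).1 xd.
  have [u eu du] := gdom_value xl.
  have [uala] : Some (u ** a) = Some (l ** a).
    by rewrite -(xc _ _ _ _ _ eu ea) -deg_comp //; exact/hullP.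
  have [<- _] := Defs.factor_inj (gm_composable eu ea) la uala du.
  by apply/hullP; rewrite du.
- move=> l m xl xm.
  have domP k : hull x k -> gdom x (deg k).
    by move=> /hullP e; rewrite /gdom /pdom /= e.
  have [p [xp lp mp]] := gact_directed (domP _ xl) (domP _ xm).
  have [k ek dk] := gdom_value xp; have xk : hull x k by apply/hullP; rewrite dk.
  by exists k; split=> //; [apply: (hull_mle xl)|apply: (hull_mle xm)]; rewrite ?dk.
Qed.

Definition hull_filter x : Defs.path_filter L := PathFilter (hull_subproof x).

Section FilterMap.
Variable F : Defs.path_filter L.

Definition segment_map (pq : Q * Q) : option L :=
  if pselect (exists k, segment F pq.1 pq.2 k) is left h
  then Some (projT1 (cid h)) else None.

(** A filter has at most one path of each degree, and paths factor uniquely, so the choice in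
    [segment_map] has only one outcome. *)
Lemma segment_mapE p q k : segment_map (p, q) = Some k <-> segment F p q k.
Proof.
rewrite /segment_map; case: pselect => /= [h|n]; last first.
  by split=> // Fk; exfalso; apply: n; exists k.
split=> [[<-]|Fk]; first exact: (projT2 (cid h)).
congr Some; case: (cid h) => j /= [m [dm mj Fmj ej]].
have [l [dl lk Flk ek]] := Fk.
have ejk : m ** j = l ** k.
  by apply: (@filter_deg_inj _ _ F) => //; rewrite !deg_comp // dm dl -ej -ek.
by have [] := Defs.factor_inj mj lk ejk (etrans dm (esym dl)).
Qed.

(** The degrees of a cofinal chain of [F] define the domain; factoring the paths of the chain
    provides the values there. *)
Lemma segment_map_is_graph_morphism : is_graph_morphism segment_map.
Proof.
have [c [Fc cS cE]] := filter_chain F (pgraph_countable L).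
split.
- exists (fun i => deg (c i)).
    by split=> [i|i j ij]; [exact: deg_pos|apply/mle_deg/chain_le/ltnW].
  apply/seteqP; split=> -[p q].
    rewrite /pdom /=; case e : (segment_map (p, q)) => [k|//] _.
    have /segment_mapE[l [<- lk Flk ->]] := e.
    have [i lki] := cE _ Flk; exists i => //; split=> /=.
    + exact: deg_pos.
    + by rewrite -deg_comp //; exact: deg_pos.
    + by exists (deg k); first exact: deg_pos.
    + by rewrite -deg_comp //; exact: mle_deg.
  move=> [i _ [/= Pp Pq [a Pa ea] [b Pb eb]]].
  have [[u v] [[/= uv euv du dv] _]] := unique_factorisation Pq Pb (esym eb).
  have Fu : filter_set F u by apply: (filter_mle _ (Fc i)); exists v.
  have [[l k] [[/= lk elk dl dk] _]] :=
    unique_factorisation Pp Pa (etrans du (esym ea)).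
  rewrite /pdom /= (_ : segment_map (p, q) = Some k) //; apply/segment_mapE.
  by exists l; split=> //; [rewrite elk|rewrite dk].
- move=> p q k /segment_mapE[l [dl lk Flk eq]]; split; apply/segment_mapE.
    exists l; split=> //; [by rewrite -lk rng_src| |by rewrite deg_unit mulg1].
    by rewrite -lk comp1r; apply: filter_mle Flk; exact: mle_comp.
  exists (l ** k); split=> //.
  + by rewrite deg_comp // dl.
  + by rewrite src_comp // rng_src.
  + by rewrite -(src_comp lk) comp1r.
  + by rewrite -(rng_src k) deg_unit mulg1.
- move=> p q r k k' /segment_mapE[l [dl lk Flk eq]] /segment_mapE[l' [dl' lk' Flk' er]].
  have Fl' : filter_set F l' by apply: filter_mle Flk'; exact: mle_comp.
  have e : l' = l ** k.
    by apply: (@filter_deg_inj _ _ F) => //; rewrite deg_comp // dl dl'.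
  subst l'; rewrite src_comp // in lk'; rewrite Defs.compA // in Flk'.
  apply/segment_mapE; exists l; split=> //; first by rewrite rng_comp.
  by rewrite er deg_comp // mulgA eq.
- by move=> p q k /segment_mapE[l [_ _ _ ->]]; rewrite mulKg.
Qed.

Definition filter_gm : graph_morphism L :=
  GraphMorphism segment_map_is_graph_morphism.

End FilterMap.

Lemma filter_gmK : cancel filter_gm hull_filter.
Proof.
move=> F; apply: path_filter_inj; apply/seteqP; split=> l /=.
  move=> /hullP/segment_mapE[u [du ul Ful _]].
  (* [u] has degree [1], so it is a unit and [u ** l] is [l]. *)
  by move: Ful; rewrite (deg1_unit du) -(src_rng u) -(deg1_unit du) ul comp1l.
move=> Fl; apply/hullP/segment_mapE; exists (rng l); split=> //.
- exact: deg_unit.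
- exact: src_rng.
- by rewrite comp1l.
- by rewrite mul1g.
Qed.

Lemma hull_filterK : cancel hull_filter filter_gm.
Proof.
by move=> x; apply: gm_hull_inj; exact: (congr1 (@filter_set L) (filter_gmK _)).
Qed.

Lemma hull_filter_continuous : continuous hull_filter.
Proof.
apply/continuousP => _ [D Dc <-]; rewrite preimage_bigcup.
apply: bigcup_open => _ /Dc[K1 [K2 [fK1 fK2 ->]]].
exists [set cylinder (@hull _ L) K1 K2]; last by rewrite bigcup_set1.
by move=> _ ->; exists K1, K2.
Qed.

Lemma filter_gm_continuous : continuous filter_gm.
Proof.
apply/continuousP => _ [D Dc <-]; rewrite preimage_bigcup.
apply: bigcup_open => _ /Dc[K1 [K2 [fK1 fK2 ->]]].
have -> : filter_gm @^-1` cylinder (@hull _ L) K1 K2 =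
    cylinder (@filter_set L) K1 K2.
  by rewrite /cylinder; apply/seteqP; split=> F /=;
    rewrite -[hull _]/(filter_set (hull_filter (filter_gm F))) filter_gmK.
exact: cylinder_open.
Qed.

Lemma gdom_hull x p : gdom x p <-> fdom (hull_filter x) p.
Proof.
split=> [/gdom_value[l xl dl]|[l /hullP xl <-]]; last by rewrite /gdom /pdom /= xl.
by exists l => //; apply/hullP; rewrite dl.
Qed.

(** The shift at [(1, deg l)] is [x] at [(p, p * deg l)], which [gm_segment] reads off the hull. *)
Lemma hull_gact x p (h : gdom x p) (k : fdom (hull_filter x) p) :
  hull_filter (gact h) = fact k.
Proof.
have Pp := gdom_pos h; apply: path_filter_inj; apply/seteqP; split=> l /=.
  move=> /hullP/shift_mapE[_ _]; rewrite mulg1 => /gm_segment[u [du ul xul _]].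
  by exists u; split=> //; apply: (filter_mle (x := hull_filter x)) xul; exact: mle_comp.
move=> [u [xu du ul xul]]; apply/hullP/shift_mapE; split.
- exact: pos1.
- exact: deg_pos.
- by rewrite mulg1; apply/gm_segment; exists u.
Qed.

Local Notation Xm := (graph_morphism_action L).
Local Notation Xf := (filter_action L).

Lemma act_eq_hull (x : Xm) p (y : Xm) q :
  act_eq x p y q <-> act_eq (hull_filter x : Xf) p (hull_filter y : Xf) q.
Proof.
split=> [[h [k hk]]|[h [k hk]]].
  exists ((gdom_hull x p).1 h), ((gdom_hull y q).1 k).
  rewrite -[LHS](hull_gact h) -[RHS](hull_gact k); congr hull_filter; exact: hk.
exists ((gdom_hull x p).2 h), ((gdom_hull y q).2 k).
apply: (can_inj hull_filterK); rewrite (hull_gact _ h) (hull_gact _ k); exact: hk.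
Qed.

Lemma hull_filter_morphism : @act_morphism Q Xm Xf hull_filter.
Proof. by move=> x p y q /act_eq_hull. Qed.

Lemma filter_gm_morphism : @act_morphism Q Xf Xm filter_gm.
Proof. by move=> F p G q FG; apply/act_eq_hull; rewrite !filter_gmK. Qed.

(** By [gm_segment], [x] takes the value [n] at [(deg l, deg l * deg n)] exactly when [l ** n] is in
    the hull, for [l] in the hull with source [rng n]. *)
Lemma boundary_gmE x : boundary_gm L x <-> meets_exhaustive (hull_filter x).
Proof.
split=> [xB l E /hullP xl fE exE El|xB p l E xl fE exE El].
  have [n En /gm_segment[u [du un xun _]]] := xB _ _ _ xl fE exE El.
  have xu : filter_set (hull_filter x) u.
    by apply: (filter_mle (x := hull_filter x)) xun; exact: mle_comp.
  have <- : u = l by apply: (filter_deg_inj (x := hull_filter x)) xu _ du; exact/hullP.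
  by exists n.
have [_ _ _ xd] := gmapP x.
have dl : deg l = p by rewrite (xd _ _ _ xl) invg1 mul1g.
have [|n En [ln xln]] := xB l E _ fE exE El; first by apply/hullP; rewrite dl.
by exists n => //; apply/gm_segment; exists l; rewrite dl.
Qed.

End Hull.

(** * Transport of the groupoids and boundaries along the hull *)

Theorem corollary5p4 (Q : wqlo_group) (L : pgraph Q) :
  finitely_aligned L ->
  exists psi : gm_groupoid L -> filter_groupoid L,
    [/\ forall g : gm_groupoid L,
          [/\ filter_set (sdp_rng (psi g)) = hull (sdp_rng g),
              sdp_coc (psi g) = sdp_coc g
            & filter_set (sdp_src (psi g)) = hull (sdp_src g)],
        groupoid_isomorphism psi,
        closed (boundary_gm L),
        act_invariant (boundary_gm L)
      & exists2 dpsi : boundary_gm_groupoid L -> boundary_filter_groupoid L,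
          forall g, red_incl (dpsi g) = psi (red_incl g)
        & groupoid_isomorphism dpsi].
Proof.
move=> La; pose h := @hull_filter Q L; pose k := @filter_gm Q L.
have hM := @hull_filter_morphism Q L; have kM := @filter_gm_morphism Q L.
have hK := @hull_filterK Q L; have kK := @filter_gmK Q L.
have hc := @hull_filter_continuous Q L; have kc := @filter_gm_continuous Q L.
(* Both boundaries amount to [meets_exhaustive]; closedness, invariance and the restricted
   isomorphism are transported through this. *)
have bE x : boundary_gm L x <-> boundary_filter L (h x).
  by rewrite boundary_filterE //; exact: boundary_gmE.
have UV (x : graph_morphism_action L) : boundary_gm L x -> boundary_filter L (h x).
  by move/bE.
have VU (F : filter_action L) : boundary_filter L F -> boundary_gm L (k F).
  by move=> ?; apply/bE; rewrite /h kK.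
exists (sdp_map hM); split.
- by [].
- exact: (sdp_map_isomorphism hM kM hK kK hc kc).
- rewrite (_ : boundary_gm L = h @^-1` boundary_filter L).
    by apply: closed_comp; [move=> x _; exact: hc|exact: closed_closure].
  by apply/seteqP; split=> x /bE.
- move=> x y p q /bE yB /act_eq_hull xy; apply/bE.
  exact: boundary_filter_invariant yB xy.
- exists (red_map hM UV); first by [].
  exact: (red_map_isomorphism hM kM hK kK hc kc UV VU).
Qed.
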